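(* Let $\ell\ge 0$ be an integer, $u\ge 0$ a real number and $\kappa\neq 0$ a real number, in the regime $u^2\ll\kappa^2$ (the frequency is much larger than $u$; in particular $u<|\kappa|$). Let $\mathcal{R}_2(\cdot,\kappa):\mathbb{R}\to\mathbb{C}$ be a solution of the scalar perturbation equation $$\left(\frac{d^2}{dr_*^2}+\kappa^2-V_S(r_* )\right)\mathcal{R}_2(r_*,\kappa)=0,\qquad r_*\in\mathbb{R},$$ with the asymptotic behaviour $\mathcal{R}_2(r_*,\kappa)\sim e^{i\kappa r_*}$ as $r_*\to-\infty$, and define the Jost function $m_2(r_*,\kappa)=e^{-i\kappa r_*}\mathcal{R}_2(r_*,\kappa)$, so that $m_2(r_*,\kappa)\to 1$ as $r_*\to-\infty$. Then $m_2$ satisfies the Volterra integral equation of the second kind $$m_2(r_*,\kappa)=1-\frac{1}{2i\kappa}\int_{-\infty}^{r_*}\left(e^{2i\kappa(r_*'-r_* )}-1\right)V_S(r_*')\,m_2(r_*',\kappa)\,dr_*'\qquad\text{for all } r_*\in\mathbb{R}.$$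
   Context: All quantities are dimensionless (lengths are measured in units of the black hole mass). The tortoise coordinate $r_*\in(-\infty,\infty)$ is related to the radial coordinate $r\in(2,\infty)$ by $r_*=r+2\ln\left(\frac{r}{2}-1\right)$, which is a smooth increasing bijection from $(2,\infty)$ onto $\mathbb{R}$; write $r=r(r_* )$ for its inverse. The effective potential for scalar perturbations of a Schwarzschild black hole in $f(R)$ gravity, viewed as a function of $r_*$, is $$V_S(r_* )=\left(1-\frac{2}{r}\right)\left[\frac{\ell(\ell+1)}{r^2}+\frac{2}{r^3}+u^2\right],\qquad r=r(r_* ).$$ It tends to $0$ as $r_*\to-\infty$ and to $u^2$ as $r_*\to+\infty$. Here $u^2=m^2 f'(0)/(3f''(0))$, with $m$ the black hole mass and $f$ the function of the Ricci scalar defining the gravity theory, and $\kappa$ is the (dimensionless) frequency of the wave, whose time dependence $e^{i\kappa t}$ has been factored out. The assumption $u^2\ll\kappa^2$ means that the parameters of the theory are chosen so that, for all practical purposes, $\sqrt{\kappa^2-u^2}$ may be identified with $\kappa$. The relation $\mathcal{R}_2(r_*,\kappa)\sim e^{i\kappa r_*}$ as $r_*\to-\infty$ means $e^{-i\kappa r_*}\mathcal{R}_2(r_*,\kappa)\to 1$ as $r_*\to-\infty$. *)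

(* Defs.v *)
From Stdlib Require Import Reals Lra.
From Coquelicot Require Import Coquelicot.
Open Scope R_scope.

Definition tortoise (r : R) : R := r + 2 * ln (r / 2 - 1).

Lemma tortoise_incr (r s : R) : 2 < r -> r < s -> tortoise r < tortoise s.
Proof.
intros Hr Hrs; unfold tortoise.
assert (ln (r / 2 - 1) < ln (s / 2 - 1)) by (apply ln_increasing; lra).
lra.
Qed.

Lemma tortoise_surj (x : R) : {r : R | 2 < r /\ tortoise r = x}.
Proof.
destruct (IVT_cor (fun y => 2 + 2 * exp y + 2 * y - x) (- Rabs x - 2) (Rabs x))
  as [y [_ Hy]].
- intro y; apply derivable_continuous_pt; reg.
- pose proof (Rabs_pos x); lra.
- pose proof (Rabs_pos x); pose proof (Rle_abs x).
  pose proof (Rle_abs (- x)) as H1; rewrite Rabs_Ropp in H1.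
  assert (exp (- Rabs x - 2) < 1) by (rewrite <- exp_0; apply exp_increasing; lra).
  pose proof (exp_pos (Rabs x)).
  apply Rmult_le_0_r; lra.
- exists (2 + 2 * exp y); pose proof (exp_pos y); split; [lra |].
  unfold tortoise; replace ((2 + 2 * exp y) / 2 - 1) with (exp y) by field.
  rewrite ln_exp; lra.
Qed.

(* The inverse of [tortoise : (2, oo) -> R]. *)
Definition radius (x : R) : R := proj1_sig (tortoise_surj x).

Lemma radius_gt2 (x : R) : 2 < radius x.
Proof. exact (proj1 (proj2_sig (tortoise_surj x))). Qed.

Lemma tortoise_radius (x : R) : tortoise (radius x) = x.
Proof. exact (proj2 (proj2_sig (tortoise_surj x))). Qed.

Lemma radius_tortoise (r : R) : 2 < r -> radius (tortoise r) = r.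
Proof.
intro Hr; pose proof (radius_gt2 (tortoise r)) as H2.
pose proof (tortoise_radius (tortoise r)) as He.
destruct (Rtotal_order (radius (tortoise r)) r) as [H | [H | H]]; trivial.
- pose proof (tortoise_incr _ _ H2 H); lra.
- pose proof (tortoise_incr _ _ Hr H); lra.
Qed.

Definition V_S (l : nat) (u x : R) : R :=
  let r := radius x in
  (1 - 2 / r) * (INR l * (INR l + 1) / r ^ 2 + 2 / r ^ 3 + u ^ 2).

(* exp (i theta) for real theta, in Coquelicot's [C = R * R]. *)
Definition expi (theta : R) : C := (cos theta, sin theta).

(* Derivatives are those of maps from R into C seen as a real normed module:
   the canonical structure on C is the complex one, hence the annotations. *)
Definition scalar_perturbation_solution
    (l : nat) (u kappa : R) (R2 : R -> C) : Prop :=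
  exists dR2 ddR2 : R -> C,
    (forall x, is_derive (V := C_R_NormedModule) R2 x (dR2 x)) /\
    (forall x, is_derive (V := C_R_NormedModule) dR2 x (ddR2 x)) /\
    (forall x, (ddR2 x + RtoC (kappa ^ 2 - V_S l u x) * R2 x = 0)%C).

Definition jost_m2 (kappa : R) (R2 : R -> C) (x : R) : C :=
  (expi (- (kappa * x)) * R2 x)%C.

Definition volterra_integrand
    (l : nat) (u kappa : R) (m : R -> C) (x x' : R) : C :=
  ((expi (2 * kappa * (x' - x)) - 1) * RtoC (V_S l u x') * m x')%C.

(* Main.v *)
(* The equation becomes [m'' + 2 i kappa m' = V_S m], so with
   [E = exp (2 i kappa (t - x))] the integrand [(E - 1) V_S m] has the primitive
   [(E - 1) m' - 2 i kappa m] in [t]. The boundary term at minus infinity only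
   needs [m' -> 0], which a mean value argument deduces from [m -> 1] and
   [V_S -> 0]. *)
Require Import Defs.
From Stdlib Require Import Reals Lra.
From Coquelicot Require Import Coquelicot.
Open Scope R_scope.

(** * Continuity of the potential and its decay at the horizon *)

(** The logarithm is increasing, so the linear term of [tortoise] alone gives slope at least 1.
    Hence the inverse [radius] is 1-Lipschitz, which yields its continuity without an inverse
    function theorem. *)
Lemma tortoise_expansive (r s : R) : 2 < r -> r <= s -> s - r <= tortoise s - tortoise r.
Proof.
intros Hr Hrs; unfold tortoise.
assert (ln (r / 2 - 1) <= ln (s / 2 - 1)) by (apply ln_le; lra).
lra.
Qed.

Lemma radius_lipschitz (x y : R) : Rabs (radius x - radius y) <= Rabs (x - y).
Proof.
pose proof (radius_gt2 x) as Hx; pose proof (radius_gt2 y) as Hy.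
pose proof (tortoise_radius x) as Ex; pose proof (tortoise_radius y) as Ey.
destruct (Rle_dec (radius x) (radius y)) as [H | H].
- pose proof (tortoise_expansive _ _ Hx H).
  rewrite (Rabs_left1 (x - y)), Rabs_left1; lra.
- assert (H' : radius y <= radius x) by lra.
  pose proof (tortoise_expansive _ _ Hy H').
  rewrite (Rabs_right (x - y)), Rabs_right; lra.
Qed.

Lemma continuous_radius (x : R) : continuous radius x.
Proof.
apply filterlim_locally; intros eps; exists eps; intros y Hy.
eapply Rle_lt_trans; [apply radius_lipschitz | exact Hy].
Qed.

Lemma continuous_V_S (l : nat) (u x : R) : continuous (V_S l u) x.
Proof.
apply (continuous_comp radius
  (fun r => (1 - 2 / r) * (INR l * (INR l + 1) / r ^ 2 + 2 / r ^ 3 + u ^ 2))).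
- apply continuous_radius.
- apply (ex_derive_continuous (K := R_AbsRing) (V := R_NormedModule)); auto_derive.
  pose proof (radius_gt2 x); repeat split; trivial; nra.
Qed.

(** Solving [tortoise r = x] for the logarithm gives [ln (r / 2 - 1) = (x - r) / 2], and [r > 2]
    bounds the right side by [(x - 2) / 2]. *)
Lemma radius_near_horizon (x : R) : radius x / 2 - 1 <= exp ((x - 2) / 2).
Proof.
pose proof (radius_gt2 x) as Hr; pose proof (tortoise_radius x) as Ht.
unfold tortoise in Ht.
rewrite <- (exp_ln (radius x / 2 - 1)) by lra.
apply Rlt_le, exp_increasing; lra.
Qed.

(** The factor [1 - 2 / r] equals [(r - 2) / r], hence is at most [r / 2 - 1], which decays
    exponentially in [x] towards the horizon. The bracket stays bounded because [/ r <= / 2]. *)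
Lemma V_S_bound (l : nat) (u x : R) :
  0 <= V_S l u x <= (INR l * (INR l + 1) + 1 + u ^ 2) * exp ((x - 2) / 2).
Proof.
pose proof (radius_gt2 x) as Hr; pose proof (radius_near_horizon x) as He.
unfold V_S; cbv zeta.
pose proof (pos_INR l) as Hl.
set (L := INR l * (INR l + 1)); assert (0 <= L) by (unfold L; nra).
set (r := radius x) in *.
assert (Hi : 0 < / r <= / 2) by (split; [apply Rinv_0_lt_compat | apply Rinv_le_contravar]; lra).
assert (H1 : 0 <= 1 - 2 / r <= r / 2 - 1).
{ replace (1 - 2 / r) with ((r - 2) * / r) by (field; lra); nra. }
assert (Hi2 : 0 <= / r * / r <= / 2) by nra.
assert (H2 : 0 <= L / r ^ 2 <= L).
{ replace (L / r ^ 2) with (L * (/ r * / r)) by (field; lra); split; nra. }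
assert (H3 : 0 <= 2 / r ^ 3 <= 1).
{ replace (2 / r ^ 3) with (2 * (/ r * (/ r * / r))) by (field; lra).
  split; nra. }
pose proof (pow2_ge_0 u).
split; [apply Rmult_le_pos; lra |].
rewrite Rmult_comm; apply Rmult_le_compat; lra.
Qed.

Lemma is_lim_V_S_horizon (l : nat) (u : R) : is_lim (V_S l u) m_infty 0.
Proof.
apply (is_lim_le_le_loc (fun _ => 0)
  (fun x => (INR l * (INR l + 1) + 1 + u ^ 2) * exp ((x - 2) / 2))).
- exists 0; intros x _; apply V_S_bound.
- apply is_lim_const.
- replace (Finite 0) with (Rbar_mult (INR l * (INR l + 1) + 1 + u ^ 2) 0)
    by (simpl; f_equal; ring).
  apply is_lim_scal_l.
  apply (is_lim_comp exp (fun x => (x - 2) / 2) m_infty 0 m_infty).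
  + apply is_lim_exp_m.
  + apply is_lim_spec; intros M; exists (2 * M); intros x Hx; lra.
  + exists 0; intros x _; discriminate.
Qed.

(** * Vanishing of a derivative at minus infinity *)

(* Over a unit interval [f] varies little, so [f'] is small somewhere, and
   [f'] itself varies little because [f' + c g] and [g] do. *)
Lemma is_lim_derive_m_infty (f f1 g h : R -> R) (c k l : R) :
  (forall x, is_derive f x (f1 x)) ->
  (forall x, is_derive (fun t => f1 t + c * g t) x (h x)) ->
  is_lim f m_infty k -> is_lim g m_infty l -> is_lim h m_infty 0 ->
  is_lim f1 m_infty 0.
Proof.
intros Df DK Lf Lg Lh.
apply is_lim_spec in Lf; apply is_lim_spec in Lg; apply is_lim_spec in Lh.
apply is_lim_spec; intros eps.
(* With tolerance [e] on each limit, the error is at most [2 e] from [f], [e] from [h] and [2 |c| e]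
   from [g]; the constant 4 leaves one [e] to spare. *)
assert (Hc : 0 < 4 + 2 * Rabs c) by (pose proof (Rabs_pos c); lra).
assert (He : 0 < eps / (4 + 2 * Rabs c))
  by (apply Rdiv_lt_0_compat; [apply cond_pos | lra]).
set (e := mkposreal _ He).
destruct (Lf e) as [Mf Hf]; destruct (Lg e) as [Mg Hg]; destruct (Lh e) as [Mh Hh].
set (M := Rmin Mf (Rmin Mg Mh)).
assert (HM : M <= Mf /\ M <= Mg /\ M <= Mh).
{ unfold M; repeat split; repeat (unfold Rmin; destruct Rle_dec); lra. }
(* The shift by 1 keeps all of [[x, x + 1]], and so both mean value points [y] and [z], below
   [M]. *)
exists (M - 1); intros x Hx.
destruct (MVT_gen f x (x + 1) f1) as [y [Hy Ey]].
{ intros t _; apply Df. }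
{ intros t _; apply continuity_pt_filterlim, (ex_derive_continuous f); eexists; apply Df. }
rewrite Rmin_left, Rmax_right in Hy by lra.
destruct (MVT_gen (fun t => f1 t + c * g t) x y h) as [z [Hz Ez]].
{ intros t _; apply DK. }
{ intros t _; apply continuity_pt_filterlim, (ex_derive_continuous (fun t => f1 t + c * g t)).
  eexists; apply DK. }
rewrite Rmin_left, Rmax_right in Hz by lra.
assert (Hfx := Hf x ltac:(lra)); assert (Hfx1 := Hf (x + 1) ltac:(lra)).
assert (Hgx := Hg x ltac:(lra)); assert (Hgy := Hg y ltac:(lra)).
assert (Hhz := Hh z ltac:(lra)).
assert (Ee : e * (4 + 2 * Rabs c) = eps) by (unfold e; simpl; field; lra).
pose proof (cond_pos e) as e_pos.
(* The first mean value equation gives [f1 y = f (x + 1) - f x]. The second compares [f1 + c g] at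
   [x] and [y], so [f1 x = f1 y - h z (y - x) + c (g y - g x)]. *)
replace (f1 x - 0) with
  ((f (x + 1) - k) - (f x - k) - (h z - 0) * (y - x)
   + c * ((g y - l) - (g x - l))) by lra.
apply Rabs_def2 in Hfx, Hfx1, Hgx, Hgy, Hhz.
assert (Rabs (c * ((g y - l) - (g x - l))) <= Rabs c * (2 * e)).
{ rewrite Rabs_mult; apply Rmult_le_compat_l; [apply Rabs_pos |].
  apply Rabs_le; lra. }
assert (Rabs ((h z - 0) * (y - x)) <= e * 1).
{ rewrite Rabs_mult; apply Rmult_le_compat; try apply Rabs_pos; apply Rabs_le; lra. }
apply Rabs_le_between in H; apply Rabs_le_between in H0.
apply Rabs_def1; lra.
Qed.

(** * Improper integrals from primitives, and componentwise calculus in C *)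

(** On each interval from [a] to [b] the fundamental theorem gives [F b - F a], and [F a] tends to
    [L] along [Fa]. Convergence of the improper integral thus comes together with its value. *)
Lemma is_RInt_gen_derive_at_point {V : CompleteNormedModule R_AbsRing}
    {Fa : (R -> Prop) -> Prop} {FFa : Filter Fa} (F f : R -> V) (b : R) (L : V) :
  (forall x, is_derive F x (f x)) -> (forall x, continuous f x) ->
  filterlim F Fa (locally L) ->
  is_RInt_gen f Fa (at_point b) (minus (F b) L).
Proof.
intros HD HC HL P HP.
assert (HQ : filterlim (fun a => minus (F b) (F a)) Fa (locally (minus (F b) L))).
{ apply (filterlim_comp_2 (fun _ => F b) (fun a => opp (F a)) plus
    (G := locally (F b)) (H := locally (opp L))).
  - apply filterlim_const.
  - eapply filterlim_comp; [exact HL | exact (filterlim_opp (K := R_AbsRing) (V := V) L)].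
  - exact (filterlim_plus (K := R_AbsRing) (V := V) (F b) (opp L)). }
apply (Filter_prod Fa (at_point b) _ (fun a => P (minus (F b) (F a))) (fun y => y = b)).
- exact (HQ P HP).
- reflexivity.
- intros a y HPa ->; exists (minus (F b) (F a)); split; trivial.
  apply is_RInt_derive; intros; [apply HD | apply HC].
Qed.

Lemma is_derive_pair (f g : R -> R) (x lf lg : R) :
  is_derive f x lf -> is_derive g x lg ->
  is_derive (V := C_R_NormedModule) (fun t => (f t, g t)) x (lf, lg).
Proof.
intros Hf Hg.

(* Expanding the pair in the basis [(1, 0)], [(0, 1)] reduces the claim to the sum and scalar
   rules. *)
apply (is_derive_ext
  (fun t => plus (scal (f t) ((1, 0) : C_R_NormedModule)) (scal (g t) ((0, 1) : C_R_NormedModule)))).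
{ intros t; apply injective_projections; simpl; unfold plus, scal, mult; simpl;
  unfold mult; simpl; ring. }
replace ((lf, lg) : C_R_NormedModule) with
  (plus (scal lf ((1, 0) : C_R_NormedModule)) (scal lg ((0, 1) : C_R_NormedModule))).
- apply (is_derive_plus (V := C_R_NormedModule));
    apply (is_derive_scal_l (K := R_AbsRing) (V := C_R_NormedModule)); assumption.
- apply injective_projections; simpl; unfold plus, scal, mult; simpl; unfold mult; simpl; ring.
Qed.

(** A projection is continuous and linear, hence its own differential, and the chain rule
    applies. *)
Lemma is_derive_fst (f : R -> C) (x : R) (l : C) :
  is_derive (V := C_R_NormedModule) f x l -> is_derive (fun t => fst (f t)) x (fst l).
Proof.
intros Hf.
apply (filterdiff_comp' (V := C_R_NormedModule) f fst x _ fst Hf).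
apply filterdiff_linear, (is_linear_fst (U := R_NormedModule) (V := R_NormedModule)).
Qed.

Lemma is_derive_snd (f : R -> C) (x : R) (l : C) :
  is_derive (V := C_R_NormedModule) f x l -> is_derive (fun t => snd (f t)) x (snd l).
Proof.
intros Hf.
apply (filterdiff_comp' (V := C_R_NormedModule) f snd x _ snd Hf).
apply filterdiff_linear, (is_linear_snd (U := R_NormedModule) (V := R_NormedModule)).
Qed.

Lemma filterlim_pair_locally {T : Type} {F : (T -> Prop) -> Prop} {FF : Filter F}
    {U V : UniformSpace} (f : T -> U) (g : T -> V) (a : U) (b : V) :
  filterlim f F (locally a) -> filterlim g F (locally b) ->
  filterlim (fun t => (f t, g t)) F (locally (a, b)).
Proof.
intros Hf Hg; apply filterlim_locally; intros eps.
apply filter_and.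
- exact (proj1 (filterlim_locally f a) Hf eps).
- exact (proj1 (filterlim_locally g b) Hg eps).
Qed.

Lemma continuous_pair (f g : R -> R) (x : R) :
  continuous f x -> continuous g x ->
  continuous (U := C_R_NormedModule) (fun t => (f t, g t)) x.
Proof. apply (filterlim_pair_locally (U := R_UniformSpace) (V := R_UniformSpace)). Qed.

(** * The Jost function as a real first-order system *)

Lemma jost_m2_pair (kappa : R) (R2 : R -> C) (x : R) :
  jost_m2 kappa R2 x =
    (cos (kappa * x) * fst (R2 x) + sin (kappa * x) * snd (R2 x),
     cos (kappa * x) * snd (R2 x) - sin (kappa * x) * fst (R2 x)).
Proof.
unfold jost_m2, expi, Cmult; simpl.
rewrite cos_neg, sin_neg; f_equal; ring.
Qed.

(* The real form of [m'' + 2 i kappa m' = V_S m], [m -> 1] for [m = p + i q]. *)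
Record jost_system (l : nat) (u kappa : R) (p q p1 q1 : R -> R) : Prop := {
  jost_p : forall x, is_derive p x (p1 x);
  jost_q : forall x, is_derive q x (q1 x);
  jost_p1 : forall x, is_derive p1 x (2 * kappa * q1 x + V_S l u x * p x);
  jost_q1 : forall x, is_derive q1 x (- 2 * kappa * p1 x + V_S l u x * q x);
  jost_lim_p : is_lim p m_infty 1;
  jost_lim_q : is_lim q m_infty 0
}.

Lemma is_lim_V_S_mult (l : nat) (u : R) (f : R -> R) (k : R) :
  is_lim f m_infty k -> is_lim (fun x => V_S l u x * f x) m_infty 0.
Proof.
intros Hf; replace (Finite 0) with (Rbar_mult 0 k) by (simpl; f_equal; ring).
apply is_lim_mult; [apply is_lim_V_S_horizon | exact Hf | exact I].
Qed.

(** The coupling term in [p1'] is [2 kappa q'], so [p1 - 2 kappa q] has derivative [V_S p], which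
    tends to 0. Symmetrically, [q1 + 2 kappa p] has derivative [V_S q]. *)
Lemma is_lim_jost_derivative (l : nat) (u kappa : R) (p q p1 q1 : R -> R) :
  jost_system l u kappa p q p1 q1 ->
  is_lim p1 m_infty 0 /\ is_lim q1 m_infty 0.
Proof.
intros [Dp Dq Dp1 Dq1 Lp Lq].
split.
- apply (is_lim_derive_m_infty p p1 q (fun x => V_S l u x * p x) (- 2 * kappa) 1 0 Dp);
    trivial.
  + intros x; evar_last.
    * apply (is_derive_plus (V := R_NormedModule)); [apply Dp1 |].
      apply is_derive_scal, Dq.
    * unfold plus; simpl; ring.
  + eapply is_lim_V_S_mult, Lp.
- apply (is_lim_derive_m_infty q q1 p (fun x => V_S l u x * q x) (2 * kappa) 0 1 Dq);
    trivial.
  + intros x; evar_last.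
    * apply (is_derive_plus (V := R_NormedModule)); [apply Dq1 |].
      apply is_derive_scal, Dp.
    * unfold plus; simpl; ring.
  + eapply is_lim_V_S_mult, Lq.
Qed.

(** * The primitive of the Volterra integrand and its limit *)

(* [(E - 1) m' - 2 i kappa m] for [m = p + i q] and [E = exp (2 i kappa (t - x))]. *)
Definition volterra_primitive (kappa : R) (p q p1 q1 : R -> R) (x t : R) : C :=
  ((cos (2 * kappa * (t - x)) - 1) * p1 t - sin (2 * kappa * (t - x)) * q1 t
     + 2 * kappa * q t,
   (cos (2 * kappa * (t - x)) - 1) * q1 t + sin (2 * kappa * (t - x)) * p1 t
     - 2 * kappa * p t).

(** Since [E' = 2 i kappa E], differentiation gives [(E - 1) m'' + 2 i kappa (E - 1) m']. The
    equation for [m''] turns this into [(E - 1) V_S m]. *)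
Lemma is_derive_volterra_primitive (l : nat) (u kappa : R) (p q p1 q1 : R -> R)
    (x t : R) :
  jost_system l u kappa p q p1 q1 ->
  is_derive (V := C_R_NormedModule) (volterra_primitive kappa p q p1 q1 x) t
    (volterra_integrand l u kappa (fun s => (p s, q s)) x t).
Proof.
intros [Dp Dq Dp1 Dq1 Lp Lq].
assert (Xp : ex_derive p t) by (eexists; apply Dp).
assert (Xq : ex_derive q t) by (eexists; apply Dq).
assert (Xp1 : ex_derive p1 t) by (eexists; apply Dp1).
assert (Xq1 : ex_derive q1 t) by (eexists; apply Dq1).
assert (Ep : Derive (fun s => p s) t = p1 t) by apply is_derive_unique, Dp.
assert (Eq : Derive (fun s => q s) t = q1 t) by apply is_derive_unique, Dq.
assert (Ep1 : Derive (fun s => p1 s) t = _) by apply is_derive_unique, Dp1.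
assert (Eq1 : Derive (fun s => q1 s) t = _) by apply is_derive_unique, Dq1.
unfold volterra_integrand, expi, Cminus, Cplus, Copp, Cmult; simpl.
apply is_derive_pair; (auto_derive; [now repeat split |]);
  rewrite ?Ep, ?Eq, ?Ep1, ?Eq1; unfold Rminus; ring.
Qed.

Lemma continuous_volterra_integrand (l : nat) (u kappa : R) (p q p1 q1 : R -> R)
    (x t : R) :
  jost_system l u kappa p q p1 q1 ->
  continuous (U := C_R_NormedModule)
    (volterra_integrand l u kappa (fun s => (p s, q s)) x) t.
Proof.
intros [Dp Dq Dp1 Dq1 Lp Lq].
assert (CV := continuous_V_S l u t).
assert (Cp : continuous p t) by (apply (ex_derive_continuous (V := R_NormedModule)); eexists; apply Dp).
assert (Cq : continuous q t) by (apply (ex_derive_continuous (V := R_NormedModule)); eexists; apply Dq).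
assert (Cc : continuous (fun t => cos (2 * kappa * (t - x)) - 1) t)
  by (apply (ex_derive_continuous (V := R_NormedModule)); now auto_derive).
assert (Cs : continuous (fun t => sin (2 * kappa * (t - x))) t)
  by (apply (ex_derive_continuous (V := R_NormedModule)); now auto_derive).
apply (continuous_ext (U := C_R_NormedModule) (fun t =>
  ((cos (2 * kappa * (t - x)) - 1) * V_S l u t * p t
     - sin (2 * kappa * (t - x)) * V_S l u t * q t,
   (cos (2 * kappa * (t - x)) - 1) * V_S l u t * q t
     + sin (2 * kappa * (t - x)) * V_S l u t * p t))).
{ intros s; unfold volterra_integrand, expi, Cminus, Cplus, Copp, Cmult; simpl; f_equal; ring. }
apply (continuous_pair
  (fun t => (cos (2 * kappa * (t - x)) - 1) * V_S l u t * p t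
     - sin (2 * kappa * (t - x)) * V_S l u t * q t)
  (fun t => (cos (2 * kappa * (t - x)) - 1) * V_S l u t * q t
     + sin (2 * kappa * (t - x)) * V_S l u t * p t)).
- apply (continuous_minus (V := R_NormedModule));
    (apply (continuous_mult (K := R_AbsRing));
      [apply (continuous_mult (K := R_AbsRing)) |]); assumption.
- apply (continuous_plus (V := R_NormedModule));
    (apply (continuous_mult (K := R_AbsRing));
      [apply (continuous_mult (K := R_AbsRing)) |]); assumption.
Qed.

(** The phase factor [E - 1] oscillates but stays bounded, while [m'] tends to 0. Only
    [- 2 i kappa m] survives, and [m] tends to 1. *)
Lemma filterlim_volterra_primitive (l : nat) (u kappa : R) (p q p1 q1 : R -> R)
    (x : R) :
  jost_system l u kappa p q p1 q1 ->
  filterlim (volterra_primitive kappa p q p1 q1 x) (Rbar_locally m_infty)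
    (locally ((0, - 2 * kappa) : C_R_NormedModule)).
Proof.
intros Hj; destruct (is_lim_jost_derivative _ _ _ _ _ _ _ Hj) as [Lp1 Lq1].
destruct Hj as [Dp Dq Dp1 Dq1 Lp Lq].
(* A bounded factor times a null one is null; the bound 2 serves both [cos - 1] and [sin]. *)
assert (Z : forall (b f : R -> R), (forall t, Rabs (b t) <= 2) ->
  is_lim f m_infty 0 -> is_lim (fun t => b t * f t) m_infty 0).
{ intros b f Hb Hf; apply is_lim_spec in Hf; apply is_lim_spec; intros eps.
  destruct (Hf (pos_div_2 eps)) as [M HM]; exists M; intros t Ht.
  specialize (HM t Ht); simpl in HM; rewrite Rminus_0_r in *; rewrite Rabs_mult.
  pose proof (Hb t); pose proof (Rabs_pos (f t)); nra. }
assert (Hc : forall t, Rabs (cos (2 * kappa * (t - x)) - 1) <= 2).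
{ intros t; pose proof (COS_bound (2 * kappa * (t - x))); apply Rabs_le; lra. }
assert (Hs : forall t, Rabs (sin (2 * kappa * (t - x))) <= 2).
{ intros t; pose proof (SIN_bound (2 * kappa * (t - x))); apply Rabs_le; lra. }
apply (filterlim_pair_locally (U := R_UniformSpace) (V := R_UniformSpace)).
- replace 0 with (0 - 0 + 2 * kappa * 0) by ring.
  apply (is_lim_plus' (fun t => (cos (2 * kappa * (t - x)) - 1) * p1 t
    - sin (2 * kappa * (t - x)) * q1 t) (fun t => 2 * kappa * q t) m_infty).
  + apply is_lim_minus'; apply Z; assumption.
  + apply (is_lim_scal_l q (2 * kappa) m_infty 0 Lq).
- replace (- 2 * kappa) with (0 + 0 - 2 * kappa * 1) by ring.
  apply (is_lim_minus' (fun t => (cos (2 * kappa * (t - x)) - 1) * q1 t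
    + sin (2 * kappa * (t - x)) * p1 t) (fun t => 2 * kappa * p t) m_infty).
  + apply is_lim_plus'; apply Z; assumption.
  + apply (is_lim_scal_l p (2 * kappa) m_infty 1 Lp).
Qed.

(** * From the wave equation to the real system *)

(** Removing the phase from [R2] cancels the [kappa ^ 2] term of the wave equation and leaves the
    first-order term [2 i kappa m']. *)
Lemma jost_system_of_solution (l : nat) (u kappa : R) (R2 : R -> C) :
  scalar_perturbation_solution l u kappa R2 ->
  filterlim (jost_m2 kappa R2) (Rbar_locally m_infty) (locally (RtoC 1)) ->
  exists p1 q1 : R -> R,
    jost_system l u kappa (fun x => fst (jost_m2 kappa R2 x))
      (fun x => snd (jost_m2 kappa R2 x)) p1 q1.
Proof.
intros [dR [ddR [D1 [D2 E]]]] Hlim.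
set (a := fun x => fst (R2 x)); set (b := fun x => snd (R2 x)).
set (a1 := fun x => fst (dR x)); set (b1 := fun x => snd (dR x)).
assert (Da : forall x, is_derive a x (a1 x)) by (intros x; exact (is_derive_fst _ _ _ (D1 x))).
assert (Db : forall x, is_derive b x (b1 x)) by (intros x; exact (is_derive_snd _ _ _ (D1 x))).
assert (Da1 : forall x, is_derive a1 x ((V_S l u x - kappa ^ 2) * a x)).
{ intros x; replace ((V_S l u x - kappa ^ 2) * a x) with (fst (ddR x)).
  - exact (is_derive_fst _ _ _ (D2 x)).
  - pose proof (f_equal fst (E x)) as Hx; simpl in Hx; unfold a; lra. }
assert (Db1 : forall x, is_derive b1 x ((V_S l u x - kappa ^ 2) * b x)).
{ intros x; replace ((V_S l u x - kappa ^ 2) * b x) with (snd (ddR x)).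
  - exact (is_derive_snd _ _ _ (D2 x)).
  - pose proof (f_equal snd (E x)) as Hx; simpl in Hx; unfold b; lra. }
assert (EDa : forall x, Derive (fun t => a t) x = a1 x)
  by (intros x; apply is_derive_unique, Da).
assert (EDb : forall x, Derive (fun t => b t) x = b1 x)
  by (intros x; apply is_derive_unique, Db).
assert (EDa1 : forall x, Derive (fun t => a1 t) x = _)
  by (intros x; apply is_derive_unique, Da1).
assert (EDb1 : forall x, Derive (fun t => b1 t) x = _)
  by (intros x; apply is_derive_unique, Db1).
assert (Xa : forall x, ex_derive a x) by (intros x; eexists; apply Da).
assert (Xb : forall x, ex_derive b x) by (intros x; eexists; apply Db).
assert (Xa1 : forall x, ex_derive a1 x) by (intros x; eexists; apply Da1).
assert (Xb1 : forall x, ex_derive b1 x) by (intros x; eexists; apply Db1).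
clearbody a1 b1.
set (p := fun x => cos (kappa * x) * a x + sin (kappa * x) * b x).
set (q := fun x => cos (kappa * x) * b x - sin (kappa * x) * a x).
(* [p1] and [q1] are the real and imaginary parts of [m' = - i kappa m + exp (- i kappa x) R2'],
   where [m = p + i q]. *)
set (p1 := fun x => kappa * q x + cos (kappa * x) * a1 x + sin (kappa * x) * b1 x).
set (q1 := fun x => - kappa * p x + cos (kappa * x) * b1 x - sin (kappa * x) * a1 x).
assert (Ep : forall x, p x = fst (jost_m2 kappa R2 x))
  by (intros x; rewrite jost_m2_pair; reflexivity).
assert (Eq : forall x, q x = snd (jost_m2 kappa R2 x))
  by (intros x; rewrite jost_m2_pair; reflexivity).
exists p1, q1; split; [intros x | intros x | intros x | intros x | |].
- apply (is_derive_ext p _ _ _ Ep); unfold p1, p, q.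
  auto_derive; [now repeat split |].
  rewrite EDa, EDb; ring.
- apply (is_derive_ext q _ _ _ Eq); unfold q1, p, q.
  auto_derive; [now repeat split |].
  rewrite EDa, EDb; ring.
- rewrite <- Ep; unfold p1, q1, p, q.
  auto_derive; [now repeat split |].
  rewrite EDa, EDb, EDa1, EDb1; ring.
- rewrite <- Eq; unfold p1, q1, p, q.
  auto_derive; [now repeat split |].
  rewrite EDa, EDb, EDa1, EDb1; ring.
- apply (filterlim_comp _ _ _ (jost_m2 kappa R2) fst _ _ _ Hlim).
  apply (continuous_fst (U := R_UniformSpace) (V := R_UniformSpace)).
- apply (filterlim_comp _ _ _ (jost_m2 kappa R2) snd _ _ _ Hlim).
  apply (continuous_snd (U := R_UniformSpace) (V := R_UniformSpace)).
Qed.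

(** * The Volterra equation *)

Theorem mainTheorem1 (l : nat) (u kappa : R) (R2 : R -> C)
    (hu : 0 <= u) (hkappa : kappa <> 0) (huk : u < Rabs kappa)
    (hR2 : scalar_perturbation_solution l u kappa R2)
    (hasymp : filterlim (jost_m2 kappa R2) (Rbar_locally m_infty)
                (locally (RtoC 1))) :
  forall x : R,
    ex_RInt_gen (V := C_R_NormedModule)
      (volterra_integrand l u kappa (jost_m2 kappa R2) x)
      (Rbar_locally m_infty) (at_point x) /\
    jost_m2 kappa R2 x =
      (1 - / (2 * Ci * RtoC kappa) *
         RInt_gen (V := C_R_CompleteNormedModule)
           (volterra_integrand l u kappa (jost_m2 kappa R2) x)
           (Rbar_locally m_infty) (at_point x))%C.
Proof.
intros x.
destruct (jost_system_of_solution l u kappa R2 hR2 hasymp) as [p1 [q1 Hj]].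
set (m := jost_m2 kappa R2) in *.
set (F := volterra_primitive kappa (fun t => fst (m t)) (fun t => snd (m t)) p1 q1 x).
(* This value gives both claims: existence of the integral, and the equation after division by
   [2 i kappa]. *)
assert (HI : is_RInt_gen (V := C_R_CompleteNormedModule)
  (volterra_integrand l u kappa m x) (Rbar_locally m_infty) (at_point x)
  (2 * Ci * RtoC kappa * (1 - m x))%C).
{ replace (2 * Ci * RtoC kappa * (1 - m x))%C
    with (minus (F x) ((0, - 2 * kappa) : C_R_CompleteNormedModule)).
  - apply (is_RInt_gen_derive_at_point (V := C_R_CompleteNormedModule) F).
    + intros t; apply (is_derive_volterra_primitive l u kappa _ _ _ _ x t) in Hj.
      unfold volterra_integrand in *; now rewrite <- surjective_pairing in Hj.
    + intros t; apply (continuous_ext (U := C_R_NormedModule)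
        (volterra_integrand l u kappa (fun s => (fst (m s), snd (m s))) x)).
      * intros s; unfold volterra_integrand; now rewrite <- surjective_pairing.
      * apply (continuous_volterra_integrand _ _ _ _ _ _ _ _ _ Hj).
    + apply (filterlim_volterra_primitive _ _ _ _ _ _ _ _ Hj).
  (* At [t = x] the phase [E] is 1, so the [m'] term drops out and [F x] is [- 2 i kappa m x];
     subtracting the limit [- 2 i kappa] leaves [2 i kappa (1 - m x)]. *)
  - unfold F, volterra_primitive; rewrite Rminus_diag, Rmult_0_r, cos_0, sin_0.
    apply injective_projections; simpl; unfold minus, plus, opp; simpl; ring. }
split; [eexists; exact HI |].
rewrite (is_RInt_gen_unique _ _ HI).
field; split; [| exact Ci_nz].
intros H; apply hkappa, RtoC_inj, H.
Qed.
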